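(* Let $f:\mathbb{R}^n\to\mathbb{R}$ be continuously differentiable with gradient $g$, and let $\{x_k\}$ be the sequence generated by the MARC algorithm (defined in the context). Write $g_k=g(x_k)$. If $\{f(x_k)\}$ is bounded below, then $$\liminf_{k\to\infty}\|g_k\|=0.$$
   Context: $\|\cdot\|$ is the Euclidean norm, $f_k=f(x_k)$, $g_k=g(x_k)$. MARC algorithm (Modified Adaptive Regularization algorithm using Cubics). Input: $x_0\in\mathbb{R}^n$ and constants $\eta_2\ge\eta_1>0$, $c_1\ge1\ge c_2>0$, $\gamma_{\max}>\gamma_0>\gamma_{\min}>0$, $\sigma_0>0$. For $k=0,1,\dots$ until convergence: 1. Set $s_k=-\dfrac{2}{\gamma_k+\sqrt{\gamma_k^2+4\sigma_k\|g_k\|}}\,g_k$, which is the exact minimizer of the cubic model $m_k(s)=f(x_k)+g_k^Ts+\frac12\gamma_k s^Ts+\frac13\sigma_k\|s\|^3$. 2. Compute $f(x_k+s_k)$ and $\rho_k=\dfrac{f(x_k)-f(x_k+s_k)}{f(x_k)-m_k(s_k)}$. 3. Set $x_{k+1}=x_k+s_k$ if $\rho_k\ge\eta_1$, and $x_{k+1}=x_k$ otherwise. 4. Set $\sigma_{k+1}=c_2\sigma_k$ if $\rho_k>\eta_2$ (very successful iteration); $\sigma_{k+1}=\sigma_k$ if $\eta_1\le\rho_k\le\eta_2$ (successful iteration); $\sigma_{k+1}=c_1\sigma_k$ otherwise (unsuccessful iteration). 5. Compute a preliminary value $\hat\gamma_{k+1}$ and set $\gamma_{k+1}=\max\{\gamma_{\min},\min\{\hat\gamma_{k+1},\gamma_{\max}\}\}$.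 With $\delta_k=x_{k+1}-x_k$ and $y_k=g_{k+1}-g_k$, the value $\hat\gamma_{k+1}$ is computed by one of the formulas: (i) $\hat\gamma_{k+1}=\dfrac{\delta_k^Ty_k}{\delta_k^T\delta_k}$; (ii) $\hat\gamma_{k+1}=\dfrac{\delta_k^Ty_k+\theta_k[2(f_k-f_{k+1})+(g_k+g_{k+1})^T\delta_k]}{\delta_k^T\delta_k}$ with $\theta_k\in[0,3]$; (iii) $\hat\gamma_{k+1}=\dfrac{r_k^Tw_k}{r_k^Tr_k}$ with $r_k=\delta_k-\psi_k\delta_{k-1}$, $w_k=y_k-\psi_ky_{k-1}$, and a scalar $\psi_k\ge0$.
   Formalization: The constants are further required to satisfy c_1 > 1 and η_1 < 3/2: if c_1 = 1 or η_1 ≥ 3/2 the claim fails, e.g. for f(x) = Lx²/2 on the real line with L large and x_0 = 1/L, where every iteration is unsuccessful and ‖g_k‖ = 1 for all k. *)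

(* Defs.v *)
From HB Require Import structures.
From mathcomp Require Import all_boot all_order all_algebra.
From mathcomp Require Import all_classical all_reals all_analysis.

Set Implicit Arguments.
Unset Strict Implicit.
Unset Printing Implicit Defensive.

Import Order.TTheory GRing.Theory Num.Theory.
Import numFieldNormedType.Exports.

Local Open Scope classical_set_scope.
Local Open Scope ring_scope.

Definition dot (R : realType) (n : nat) (u v : 'cV[R]_n) : R :=
  (u^T *m v) ord0 ord0.

(* The library norm `|u| on matrices is the max norm.  It induces the same
   topology, and the same notion of differentiability, as [enorm]. *)
Definition enorm (R : realType) (n : nat) (u : 'cV[R]_n) : R :=
  Num.sqrt (dot u u).

Definition continuously_differentiable_with_gradient (R : realType) (n : nat)
    (f : 'cV[R]_n -> R) (g : 'cV[R]_n -> 'cV[R]_n) : Prop :=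
  [/\ forall x, differentiable f x,
      forall x v, 'd f x v = dot (g x) v
    & continuous g].

Record marc_constants (R : realType) := MarcConstants {
  eta1 : R; eta2 : R;
  c1 : R; c2 : R;
  gamma_min : R; gamma_init : R; gamma_max : R;
  sigma_init : R
}.

(* c1 = 1 and large values of eta1 are admissible here, but liminf |g(x_k)| = 0
   fails for every choice of constants with c1 = 1 or 3/2 <= eta1: on
   f(x) = L * x^2 / 2 in dimension 1, with L large, all iterations started from
   x0 = 1/L are unsuccessful and x_k = x0 for all k. *)
Definition admissible (R : realType) (P : marc_constants R) : Prop :=
  [/\ 0 < eta1 P <= eta2 P,
      0 < c2 P <= 1,
      1 <= c1 P,
      0 < gamma_min P < gamma_init P /\ gamma_init P < gamma_max P
    & 0 < sigma_init P].

Definition cubic_model (R : realType) (n : nat)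
    (f : 'cV[R]_n -> R) (g : 'cV[R]_n -> 'cV[R]_n)
    (x : 'cV[R]_n) (sigma gamma : R) (s : 'cV[R]_n) : R :=
  f x + dot (g x) s + 1 / 2 * gamma * dot s s + 1 / 3 * sigma * enorm s ^+ 3.

Definition marc_step (R : realType) (n : nat)
    (g : 'cV[R]_n -> 'cV[R]_n) (x : 'cV[R]_n) (sigma gamma : R) : 'cV[R]_n :=
  - (2 / (gamma + Num.sqrt (gamma ^+ 2 + 4 * sigma * enorm (g x)))) *: g x.

(* If g x = 0 then s = 0 and this is 0 / 0; the iterate is then kept whatever
   the value, so the run stays at the stationary point where the algorithm
   would have stopped. *)
Definition marc_ratio (R : realType) (n : nat)
    (f : 'cV[R]_n -> R) (g : 'cV[R]_n -> 'cV[R]_n)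
    (x : 'cV[R]_n) (sigma gamma : R) : R :=
  let s := marc_step g x sigma gamma in
  (f x - f (x + s)) / (f x - cubic_model f g x sigma gamma s).

(* A formula with a vanishing denominator (for instance after an unsuccessful
   iteration, where x_(k+1) = x_k) leaves the value arbitrary. *)
Definition quotient_value (R : realType) (num den value : R) : Prop :=
  den != 0 -> value = num / den.

(* Admissible preliminary values for gamma_(k+1).  In the third formula, the
   vectors with index -1 that occur when k = 0 are arbitrary. *)
Definition preliminary_gamma (R : realType) (n : nat)
    (f : 'cV[R]_n -> R) (g : 'cV[R]_n -> 'cV[R]_n)
    (x : nat -> 'cV[R]_n) (k : nat) (gammahat : R) : Prop :=
  let delta j := x j.+1 - x j in
  let y j := g (x j.+1) - g (x j) in
  [\/ quotient_value (dot (delta k) (y k)) (dot (delta k) (delta k)) gammahat,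
      exists2 theta : R, 0 <= theta <= 3 &
        quotient_value
          (dot (delta k) (y k)
           + theta * (2 * (f (x k) - f (x k.+1))
                      + dot (g (x k) + g (x k.+1)) (delta k)))
          (dot (delta k) (delta k)) gammahat
    | exists (psi : R) (delta_prev y_prev : 'cV[R]_n),
        [/\ 0 <= psi,
            (0 < k)%N -> delta_prev = delta k.-1 /\ y_prev = y k.-1
          & let r := delta k - psi *: delta_prev in
            let w := y k - psi *: y_prev in
            quotient_value (dot r w) (dot r r) gammahat]].

Record marc_run (R : realType) (n : nat) (P : marc_constants R)
    (f : 'cV[R]_n -> R) (g : 'cV[R]_n -> 'cV[R]_n) (x0 : 'cV[R]_n)
    (x : nat -> 'cV[R]_n) (sigma gamma : nat -> R) : Prop := MarcRun {
  run_x0 : x 0%N = x0;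
  run_sigma0 : sigma 0%N = sigma_init P;
  run_gamma0 : gamma 0%N = gamma_init P;
  run_x : forall k,
    x k.+1 = if eta1 P <= marc_ratio f g (x k) (sigma k) (gamma k)
             then x k + marc_step g (x k) (sigma k) (gamma k)
             else x k;
  run_sigma : forall k,
    let rho := marc_ratio f g (x k) (sigma k) (gamma k) in
    sigma k.+1 = if eta2 P < rho then c2 P * sigma k
                 else if eta1 P <= rho then sigma k
                 else c1 P * sigma k;
  run_gamma : forall k, exists2 gammahat : R,
    preliminary_gamma f g x k gammahat &
    gamma k.+1 = Num.max (gamma_min P) (Num.min gammahat (gamma_max P))
}.

(* Main.v *)
Require Import Defs.
From HB Require Import structures.
From mathcomp Require Import all_boot all_order all_algebra.
From mathcomp Require Import all_classical all_reals all_analysis.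
From mathcomp Require Import ring lra.

Set Implicit Arguments.
Unset Strict Implicit.
Unset Printing Implicit Defensive.

Import Order.TTheory GRing.Theory Num.Theory.
Import numFieldNormedType.Exports.

Local Open Scope classical_set_scope.
Local Open Scope ring_scope.

(** If the gradients do not have inferior limit [0], then some tail of the run
    satisfies [eps <= |g_k|] with [eps > 0]; this is refuted by
    [gradients_not_bounded_away].

    Everything is expressed through the step length [s = |s_k|].  The step is a
    negative multiple of the gradient whose length is the positive root of
    [sigma s^2 + gamma s = |g_k|] ([enorm_marc_step]), and the decrease predicted
    by the cubic model lies between [s |g_k| / 2] and [2 s |g_k| / 3]
    ([predicted_decrease_bounds]).  Hence a successful iteration decreases [f] by
    at least [eta1 eps s / 2], a fixed multiple of the distance travelled.  As
    [f(x_k)] is bounded below, the iterates travel a finite total distance and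
    converge to a point [z], where [|g z| >= eps] by continuity.

    Close to [z] the gradient is nearly constant, so for short steps the actual
    decrease is nearly [s |g_k|] while the predicted one is at most
    [2 s |g_k| / 3]: the ratio is nearly [3/2] or more, which exceeds [eta1].
    So there is [delta > 0] such that, from some index on, every step
    shorter than [delta] is accepted ([short_steps_successful]).
    An unsuccessful iteration therefore has [s >= delta], and then
    [sigma s^2 <= |g_k|] bounds [sigma].  Since [sigma] grows at unsuccessful
    iterations only, it is bounded.  With [sigma] and [gamma] bounded and
    [|g_k| >= eps], the equation for [s] keeps [s] away from [0]
    ([quadratic_root_lower_bound]), so each successful iteration decreases [f]
    by a fixed amount, and only finitely many can occur.  After the last one,
    [sigma] is multiplied by [c1 > 1] forever, which contradicts its
    boundedness. *)

(** * Euclidean geometry and calculus *)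

Section Euclid.
Variables (R : realType) (n : nat).
Implicit Types u v : 'cV[R]_n.

Lemma dotE u v : dot u v = \sum_i u i ord0 * v i ord0.
Proof. by rewrite /dot mxE; apply: eq_bigr => i _; rewrite mxE. Qed.

Lemma dotZl a u v : dot (a *: u) v = a * dot u v.
Proof. by rewrite !dotE mulr_sumr; apply: eq_bigr => i _; rewrite mxE mulrA. Qed.

Lemma dotZr a u v : dot u (a *: v) = a * dot u v.
Proof. by rewrite /dot -scalemxAr mxE. Qed.

Lemma dot_ge0 u : 0 <= dot u u.
Proof. by rewrite dotE; apply: sumr_ge0 => i _; rewrite -expr2 sqr_ge0. Qed.

Lemma enorm_ge0 u : 0 <= enorm u.
Proof. exact: sqrtr_ge0. Qed.

Lemma enorm_sqr u : enorm u ^+ 2 = dot u u.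
Proof. by rewrite sqr_sqrtr ?dot_ge0. Qed.

Lemma enormZ a u : enorm (a *: u) = `|a| * enorm u.
Proof.
by rewrite /enorm dotZl dotZr mulrA -expr2 sqrtrM ?sqr_ge0// sqrtr_sqr.
Qed.

(** [`|u|] is the maximum norm; the inequality transfers estimates of
    Euclidean step lengths to the metric in which limits are taken. *)
Lemma normr_le_enorm u : `|u| <= enorm u.
Proof.
rewrite [leLHS]/Num.Def.normr /= mx_normrE; apply: bigmax_le; first exact: enorm_ge0.
move=> [i j] _ /=; rewrite (ord1 j) -sqrtr_sqr ler_wsqrtr// dotE.
rewrite (bigD1 i)//= expr2 lerDl sumr_ge0// => k _.
by rewrite -expr2 sqr_ge0.
Qed.

Lemma dot_continuous (T : topologicalType) (F G : T -> 'cV[R]_n) (z : T) :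
  {for z, continuous F} -> {for z, continuous G} ->
  {for z, continuous (fun t => dot (F t) (G t))}.
Proof.
move=> Fz Gz.
have -> : (fun t => dot (F t) (G t)) =
    (fun t => \sum_(i < n) F t i ord0 * G t i ord0).
  by apply/funext => t; exact: dotE.
rewrite /prop_for /continuous_at; apply: cvg_big => [|i _]; first exact: add_continuous.
apply: cvgM.
- exact: (continuous_comp Fz (@coord_continuous _ _ _ _ _ _)).
- exact: (continuous_comp Gz (@coord_continuous _ _ _ _ _ _)).
Qed.

Lemma enorm_continuous : continuous (@enorm R n).
Proof.
move=> u; apply: (@continuous_comp _ _ _ (fun v => dot v v) Num.sqrt u).
  by apply: dot_continuous; exact: cvg_id.
exact: sqrt_continuous.
Qed.

(** Apply the mean value theorem to [u |-> f (x + u *: v)] on [[0, 1]], whose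
    derivative at [u] is the pairing of [v] with the gradient at [x + u *: v]. *)
Lemma mean_value_gradient (f : 'cV[R]_n -> R) (g : 'cV[R]_n -> 'cV[R]_n) x v :
  continuously_differentiable_with_gradient f g ->
  exists2 c : R, 0 <= c <= 1 & f (x + v) - f x = dot (g (x + c *: v)) v.
Proof.
move=> [df dfE _].
pose phi (u : R) := f (x + u *: v).
have dphi (u : R) : is_derive u (1 : R) phi (dot (g (x + u *: v)) v).
  have dl : is_diff u (fun u : R => x + u *: v) (fun h => h *: v).
    have -> : (fun h : R => h *: v) = (0 : R -> 'cV[R]_n) + (fun h => h *: v).
      by rewrite add0r.
    exact: is_diffD.
  have dphi : differentiable phi u.
    by apply: differentiable_comp => //; exact: df.
  apply: DeriveDef; first exact: diff_derivable.
  rewrite deriveE// diff_comp//= diff_val scale1r; exact: dfE.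
have [||c] := @MVT_segment R phi (fun u : R => dot (g (x + u *: v)) v) 0 1.
- exact: ler01.
- apply: continuous_subspaceT => u.
  by apply: differentiable_continuous; apply/derivable1_diffP; case: (dphi u).
- rewrite in_itv /= => c01; rewrite /phi scale1r scale0r addr0 subr0 mulr1.
  by exists c.
Qed.

End Euclid.

(** A sequence whose displacements are paid for by the decrease of a quantity
    bounded below has finite total length, so it converges. *)
Lemma cvgn_telescope_bound (R : realType) (V : completeNormedModType R)
    (x : nat -> V) (a : nat -> R) :
  (forall k, `|x k.+1 - x k| <= a k - a k.+1) -> has_lbound (range a) ->
  cvgn x.
Proof.
move=> xa [b ba].
have bnd m : series (fun k => `|telescope x k|) m <= a 0%N - a m.
  elim: m => [|m IH]; rewrite seriesEnat /=; first by rewrite big_geq// subrr.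
  rewrite big_nat_recr//=.
  by have := xa m; move: IH; rewrite seriesEnat /telescope /=; lra.
have /normed_cvg : cvgn [normed series (telescope x)].
  apply: nondecreasing_is_cvgn.
    by apply: nondecreasing_series => k _ _; exact: normr_ge0.
  exists (a 0%N - b) => _ [m _ <-]; apply: (le_trans (bnd m)).
  by rewrite lerD2l lerN2; apply: ba; exists m.
move=> cs.
have -> : x = (fun m => x 0%N + series (telescope x) m).
  by apply/funext => m; exact: eq_sum_telescope.
by apply: is_cvgD => //; exact: is_cvg_cst.
Qed.

(** * The cubic regularization step *)

Section Step.
Variables (R : realType) (n : nat).
Variables (f : 'cV[R]_n -> R) (g : 'cV[R]_n -> 'cV[R]_n).
Variables (x : 'cV[R]_n) (sigma gamma : R).
Hypotheses (sigma_gt0 : 0 < sigma) (gamma_gt0 : 0 < gamma).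

Let G := enorm (g x).
Let s := marc_step g x sigma gamma.

(** Rationalizing the quotient in the definition of the step shows that its
    coefficient [t] is the positive root of this quadratic equation; all later
    facts use the equation only. *)
Lemma marc_step_factor : exists t : R,
  [/\ 0 < t, s = - t *: g x & sigma * t ^+ 2 * G + gamma * t = 1].
Proof.
pose q := Num.sqrt (gamma ^+ 2 + 4 * sigma * G).
have G0 : 0 <= G := enorm_ge0 _.
have q0 : 0 <= q := sqrtr_ge0 _.
have q2 : q ^+ 2 = gamma ^+ 2 + 4 * sigma * G.
  by rewrite sqr_sqrtr// addr_ge0 ?sqr_ge0// !mulr_ge0// ltW.
exists (2 / (gamma + q)); split => //; first by rewrite divr_gt0// ltr_pwDl.
have d0 : gamma + q != 0 by rewrite gt_eqF// ltr_pwDl.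
have -> : sigma * (2 / (gamma + q)) ^+ 2 * G + gamma * (2 / (gamma + q))
  = (4 * sigma * G + 2 * gamma * (gamma + q)) / (gamma + q) ^+ 2.
  by field.
have -> : 4 * sigma * G + 2 * gamma * (gamma + q) = (gamma + q) ^+ 2.
  by rewrite sqrrD q2; ring.
by rewrite divff// expf_neq0.
Qed.

Lemma enorm_marc_step : sigma * enorm s ^+ 2 + gamma * enorm s = G.
Proof.
have [t [t0 -> tE]] := marc_step_factor.
rewrite enormZ normrN gtr0_norm// -/G.
by rewrite -[RHS]mulr1 -tE; ring.
Qed.

Lemma marc_step_direction : G *: s = - enorm s *: g x.
Proof.
have [t [t0 -> _]] := marc_step_factor.
by rewrite enormZ normrN gtr0_norm// !scalerA mulrN mulrC.
Qed.

(** The equation for the step length eliminates [sigma], so that [sigma] and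
    [gamma] enter only through [gamma * s], a quantity between [0] and [G]. *)
Lemma predicted_decrease :
  f x - cubic_model f g x sigma gamma s
  = enorm s * (2 / 3 * G - gamma * enorm s / 6).
Proof.
have gs : dot (g x) s = - (enorm s * G).
  have [t [t0 -> _]] := marc_step_factor.
  by rewrite enormZ normrN gtr0_norm// dotZr -enorm_sqr -/G; ring.
rewrite /cubic_model -enorm_sqr gs -enorm_marc_step; by field.
Qed.

(** [gamma * s] lies between [0] and [G] because the other term [sigma * s ^ 2] of
    the equation for the step length is nonnegative. *)
Lemma predicted_decrease_bounds :
  enorm s * G / 2 <= f x - cubic_model f g x sigma gamma s
                  <= 2 / 3 * (enorm s * G).
Proof.
have s0 : 0 <= enorm s := enorm_ge0 _.
have gs0 : 0 <= gamma * enorm s by rewrite mulr_ge0// ltW.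
have gsG : gamma * enorm s <= G.
  by rewrite -enorm_marc_step lerDr mulr_ge0 ?sqr_ge0// ltW.
by rewrite predicted_decrease; apply/andP; split; nra.
Qed.

Lemma marc_step_gt0 : 0 < G -> 0 < enorm s.
Proof.
move=> G0; rewrite lt0r enorm_ge0 andbT; apply/eqP => s0.
by move: G0; rewrite -enorm_marc_step s0 expr0n/= !mulr0 addr0 ltxx.
Qed.

Lemma successful_decrease (eta : R) : 0 < eta -> 0 < G ->
  eta <= marc_ratio f g x sigma gamma ->
  eta * (enorm s * G / 2) <= f x - f (x + s).
Proof.
move=> eta0 G0; have /andP[lo _] := predicted_decrease_bounds.
have s0 := marc_step_gt0 G0.
rewrite /marc_ratio -/s ler_pdivlMr; last first.
  by apply: lt_le_trans lo; rewrite divr_gt0// mulr_gt0.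
by apply: le_trans; rewrite ler_pM2l.
Qed.

Lemma successful_of_decrease (eta : R) : 0 <= eta -> 0 < G ->
  eta * (2 / 3 * (enorm s * G)) <= f x - f (x + s) ->
  eta <= marc_ratio f g x sigma gamma.
Proof.
move=> eta0 G0 dec; have /andP[lo hi] := predicted_decrease_bounds.
have s0 := marc_step_gt0 G0.
rewrite /marc_ratio -/s ler_pdivlMr; last first.
  by apply: lt_le_trans lo; rewrite divr_gt0// mulr_gt0.
by apply: le_trans dec; rewrite ler_wpM2l.
Qed.

End Step.

(** As [2 * eta / 3 < 1], continuity gives
    [dot (g y) (g w) > (2 * eta / 3) * dot (g w) (g w)] for [y], [w] close to [z].
    With [w := x] and [y] the mean value point of the step, the actual decrease
    is at least [eta * (2 / 3 * s * |g x|)], which is [eta] times an upper bound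
    of the predicted decrease. *)
Lemma short_steps_successful (R : realType) (n : nat)
    (f : 'cV[R]_n -> R) (g : 'cV[R]_n -> 'cV[R]_n) (eta : R) (z : 'cV[R]_n) :
  continuously_differentiable_with_gradient f g ->
  0 <= eta < 3 / 2 -> 0 < enorm (g z) ->
  exists2 delta : R, 0 < delta & forall x sigma gamma,
    0 < sigma -> 0 < gamma -> `|x - z| < delta ->
    enorm (marc_step g x sigma gamma) < delta ->
    eta <= marc_ratio f g x sigma gamma.
Proof.
move=> fC1 /andP[eta0 eta32] gz0.
have [_ _ gC] := fC1.
pose kappa := eta * (2 / 3).
have kappa1 : kappa < 1 by rewrite /kappa; lra.
pose h (p : 'cV[R]_n * 'cV[R]_n) :=
  dot (g p.1) (g p.2) - kappa * dot (g p.2) (g p.2).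
have hC : {for (z, z), continuous h}.
  have c1 : {for (z, z), continuous (fun p : 'cV[R]_n * 'cV[R]_n => g p.1)}.
    by apply: (@continuous_comp _ _ _ fst g); [exact: cvg_fst|exact: gC].
  have c2 : {for (z, z), continuous (fun p : 'cV[R]_n * 'cV[R]_n => g p.2)}.
    by apply: (@continuous_comp _ _ _ snd g); [exact: cvg_snd|exact: gC].
  apply: cvgB; first exact: (dot_continuous c1 c2).
  by apply: cvgMr; exact: (dot_continuous c2 c2).
have hz0 : 0 < h (z, z).
  rewrite /h /= -enorm_sqr -{1}[_ ^+ 2]mul1r -mulrBl.
  by rewrite mulr_gt0 ?exprn_gt0// subr_gt0.
have [[A B] /= [/nbhs_normP[a a0 aA] /nbhs_normP[b b0 bB]] ABh] :=
  cvgr_gt _ hC _ hz0.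
have h_gt0 y w : `|y - z| < a -> `|w - z| < b -> 0 < h (y, w).
  move=> yz wz; apply: (ABh (y, w)); split => /=.
    by apply: aA; rewrite /ball_ /= distrC.
  by apply: bB; rewrite /ball_ /= distrC.
(* Halved because the mean value point may be off [z] by the distance of [x]
   plus the step length. *)
exists (Num.min a b / 2); first by rewrite divr_gt0// lt_min a0.
move=> x sigma gamma sigma0 gamma0; set d := Num.min a b.
have da : d <= a by rewrite /d ge_min lexx.
have db : d <= b by rewrite /d ge_min lexx orbT.
have d0 : 0 < d by rewrite /d lt_min a0.
move=> xz sd; set s := marc_step g x sigma gamma in sd *.
(* At [y = w = x] the inequality forces the gradient to be nonzero. *)
have xxh : 0 < h (x, x) by apply: h_gt0; lra.
have G0 : 0 < enorm (g x).
  rewrite lt0r enorm_ge0 andbT; apply/eqP => gx0.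
  by move: xxh; rewrite /h /= -enorm_sqr gx0 expr0n /= mulr0 subr0 ltxx.
apply: successful_of_decrease => //; rewrite -/s.
have [c /andP[c0 c1] fE] := mean_value_gradient x s fC1.
have xih : 0 < h (x + c *: s, x).
  apply: h_gt0; last lra.
  have -> : x + c *: s - z = (x - z) + c *: s by rewrite addrAC.
  apply: (le_lt_trans (ler_normD _ _)); rewrite normrZ (ger0_norm c0).
  have := normr_le_enorm s; have := normr_ge0 s; nra.
(* Multiplied by [enorm (g x)] to avoid dividing in the step direction. *)
have sdir : enorm (g x) * dot (g (x + c *: s)) s
    = - (enorm s * dot (g (x + c *: s)) (g x)).
  by rewrite -dotZr marc_step_direction// dotZr mulNr.
rewrite -opprB fE -(ler_pM2l G0) mulrN sdir opprK.
have s0 : 0 <= enorm s := enorm_ge0 _.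
move: xih; rewrite /h /= -enorm_sqr /kappa => xih.
nra.
Qed.

(** * Behaviour of the run *)

(** The step length cannot be small when its coefficients are bounded and the
    gradient norm, the value of the quadratic expression, is bounded below. *)
Lemma quadratic_root_lower_bound (R : realType) (M L e : R) :
  0 <= M -> 0 <= L -> 0 < e ->
  exists2 s0 : R, 0 < s0 & forall sigma gamma s : R,
    0 <= s -> sigma <= M -> gamma <= L ->
    e <= sigma * s ^+ 2 + gamma * s -> s0 <= s.
Proof.
move=> M0 L0 e0; have d0 : 0 < e + M + L by lra.
(* This witness is at most [1], so below it [s ^ 2 <= s] and the quadratic
   expression is at most [(M + L) * s], which is less than [e]. *)
exists (e / (e + M + L)) => [|sigma gamma s s0 sM gL es]; first exact: divr_gt0.
rewrite ler_pdivrMr//.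
have [s1|s1] := leP 1 s; first by nra.
have : e <= M * s + L * s.
  apply: (le_trans es); apply: lerD; last by rewrite ler_wpM2r.
  by rewrite expr2 mulrA ler_wpM2r//; nra.
nra.
Qed.

(** Joins the completeness and the norm of column vectors, so that absolutely
    convergent series of displacements converge. *)
HB.instance Definition _ (R : realType) (n : nat) := Complete.on 'cV[R]_n.

(** The initial values are not fixed, and the update of [gamma] is only required
    to keep it in a bounded range, so that the lemma applies to every tail of a
    run. *)
Lemma gradients_not_bounded_away (R : realType) (n : nat)
    (f : 'cV[R]_n -> R) (g : 'cV[R]_n -> 'cV[R]_n) (P : marc_constants R)
    (x : nat -> 'cV[R]_n) (sigma gamma : nat -> R) (L eps : R) :
  continuously_differentiable_with_gradient f g ->
  admissible P -> 1 < c1 P -> eta1 P < 3 / 2 ->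
  (forall k, x k.+1 =
     if eta1 P <= marc_ratio f g (x k) (sigma k) (gamma k)
     then x k + marc_step g (x k) (sigma k) (gamma k) else x k) ->
  (forall k, let rho := marc_ratio f g (x k) (sigma k) (gamma k) in
     sigma k.+1 = if eta2 P < rho then c2 P * sigma k
                  else if eta1 P <= rho then sigma k else c1 P * sigma k) ->
  (forall k, 0 < sigma k) -> (forall k, 0 < gamma k <= L) ->
  has_lbound (range (fun k => f (x k))) ->
  0 < eps -> ~ (forall k, eps <= enorm (g (x k))).
Proof.
move=> fC1 [/andP[eta1_gt0 eta12] /andP[c2_gt0 c2_le1] _ _ _] c1_gt1 eta1_lt.
move=> xS sigmaS sigma_gt0 gamma_bnd fx_lb eps0 g_ge.
have gamma_gt0 k : 0 < gamma k by case/andP: (gamma_bnd k).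
have gamma_le k : gamma k <= L by case/andP: (gamma_bnd k).
have L0 : 0 < L by apply: lt_le_trans (gamma_gt0 0%N) (gamma_le 0%N).
have g_gt0 k : 0 < enorm (g (x k)) by apply: lt_le_trans (g_ge k).
pose success k := eta1 P <= marc_ratio f g (x k) (sigma k) (gamma k).
pose s k := enorm (marc_step g (x k) (sigma k) (gamma k)).
have s_ge0 k : 0 <= s k := enorm_ge0 _.
have sE k : sigma k * s k ^+ 2 + gamma k * s k = enorm (g (x k)).
  exact: enorm_marc_step.
have decrease k : success k ->
    eta1 P * eps / 2 * s k <= f (x k) - f (x k.+1).
  move=> sk; rewrite xS -/(success k) sk.
  apply: le_trans (successful_decrease _ _ eta1_gt0 _ sk) => //.
  have : s k * eps <= s k * enorm (g (x k)) by rewrite ler_wpM2l.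
  by rewrite -/(s k); nra.
(* The iterates converge: they move at successful iterations only, and then by a
   distance dominated by the decrease of [f]. *)
have /cvg_ex[z xz] : cvgn x.
  pose C := eta1 P * eps / 2.
  have C0 : 0 < C by rewrite /C divr_gt0// mulr_gt0.
  apply: (cvgn_telescope_bound (a := fun k => f (x k) / C)) => [k|].
    rewrite -mulrBl ler_pdivlMr// mulrC.
    have [sk|/negbTE sk] := boolP (success k).
      apply: le_trans (decrease _ sk); rewrite ler_pM2l//.
      rewrite xS -/(success k) sk addrC addKr; exact: normr_le_enorm.
    by rewrite xS -/(success k) sk !subrr normr0 mulr0.
  case: fx_lb => b fb; exists (b / C) => _ [k _ <-].
  by rewrite ler_pM2r ?invr_gt0//; apply: fb; exists k.
have [fd _ gC] := fC1.
have gxz : enorm (g (x k)) @[k --> \oo] --> enorm (g z).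
  have gx : g (x k) @[k --> \oo] --> g z.
    exact: (continuous_cvg _ (gC z) xz).
  exact: (continuous_cvg _ (@enorm_continuous R n (g z)) gx).
have gz0 : 0 < enorm (g z).
  apply: (lt_le_trans eps0); rewrite leNgt; apply/negP => gz.
  have [N _ /(_ N (leqnn N)) /=] := cvgr_lt _ gxz _ gz.
  by rewrite ltNge g_ge.
have [delta delta0 short_success] :
    exists2 delta : R, 0 < delta & forall x sigma gamma,
      0 < sigma -> 0 < gamma -> `|x - z| < delta ->
      enorm (marc_step g x sigma gamma) < delta ->
      eta1 P <= marc_ratio f g x sigma gamma.
  by apply: short_steps_successful => //; rewrite (ltW eta1_gt0) eta1_lt.
(* Near [z] unsuccessful steps are long, and long steps need a small [sigma]. *)
pose B := enorm (g z) + 1.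
have B0 : 0 < B by rewrite /B; lra.
have [N _ near_z] : \forall k \near \oo,
    `|x k - z| < delta /\ enorm (g (x k)) < B.
  near=> k; split; near: k.
    exact: (cvgr_distC_lt _ _ xz).
  by apply: (cvgr_lt _ gxz); rewrite /B ltrDl.
have fail_sigma k : (N <= k)%N -> ~~ success k -> sigma k <= B / delta ^+ 2.
  move=> /near_z[/= xkz gkB] /negP fk.
  have sk : delta <= s k.
    by rewrite leNgt; apply/negP => sk; apply: fk; exact: short_success.
  rewrite ler_pdivlMr ?exprn_gt0//; apply: le_trans (ltW gkB).
  rewrite -sE; apply: (@le_trans _ _ (sigma k * s k ^+ 2)).
    by rewrite ler_pM2l// ler_pXn2r ?nnegrE ?s_ge0 ?(ltW delta0).
  by rewrite lerDl mulr_ge0// ltW.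
pose M := Num.max (sigma N) (c1 P * (B / delta ^+ 2)).
have sigma_le j : sigma (N + j)%N <= M.
  elim: j => [|j IH]; first by rewrite addn0 /M le_max lexx.
  rewrite addnS sigmaS; case: ifPn => [_|_].
    by apply: le_trans IH; rewrite ger_pMl.
  case: ifPn => // fk; rewrite /M le_max ler_pM2l ?(lt_trans ltr01)//.
  by rewrite fail_sigma ?orbT// leq_addr.
have M0 : 0 <= M by apply: le_trans (sigma_le 0%N); exact: ltW.
(* With [sigma] bounded, a successful step would decrease [f] by an amount that
   the convergence of [f (x k)] eventually forbids. *)
have [s0 s0_gt0 s_ge] := quadratic_root_lower_bound M0 (ltW L0) eps0.
have [N' _ small_dec] : \forall k \near \oo,
    f (x k) - f (x k.+1) < eta1 P * eps / 2 * s0.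
  have fxz : f (x k) @[k --> \oo] --> f z.
    exact: (continuous_cvg _ (differentiable_continuous (fd z)) xz).
  have fd0 : f (x k) - f (x k.+1) @[k --> \oo] --> 0.
    rewrite -[X in _ --> X](subrr (f z)); apply: cvgB => //.
    by rewrite (cvg_shiftS (fun k => f (x k))).
  by apply: (cvgr_lt _ fd0); rewrite mulr_gt0// divr_gt0// mulr_gt0.
pose K := (N + N')%N.
have all_fail j : ~~ success (K + j)%N.
  apply/negP => /decrease.
  have : s0 <= s (K + j)%N.
    apply: (s_ge (sigma (K + j)%N) (gamma (K + j)%N)) => //.
      by rewrite /K -addnA sigma_le.
    by rewrite sE.
  have /small_dec /= : (N' <= K + j)%N by rewrite /K addnAC leq_addl.
  have : 0 < eta1 P * eps / 2 by rewrite divr_gt0// mulr_gt0.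
  nra.
(* By Bernoulli's inequality; linear growth is enough to exceed [M]. *)
have sigma_growth j :
    sigma K * (1 + j%:R * (c1 P - 1)) <= sigma (K + j)%N.
  have sK := sigma_gt0 K.
  elim: j => [|j IH]; first by rewrite mul0r addr0 mulr1 addn0.
  rewrite addnS sigmaS.
  have fk := all_fail j.
  rewrite ifN; last first.
    by apply: contra fk => /ltW; exact: le_trans.
  rewrite ifN//.
  have j0 : (0 : R) <= j%:R by [].
  rewrite -natr1.
  have : sigma K <= sigma (K + j)%N.
    apply: le_trans IH; rewrite ler_pMr// lerDl mulr_ge0// subr_ge0 ltW//.
  nra.
have [j jM] : exists j : nat, M / (sigma K * (c1 P - 1)) < j%:R.
  exists (Num.bound (M / (sigma K * (c1 P - 1)))).
  by apply: archi_boundP; rewrite divr_ge0// mulr_ge0// ?subr_ge0 ltW.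
move: jM; rewrite ltr_pdivrMr ?mulr_gt0 ?subr_gt0// => jM.
have := sigma_growth j; have := sigma_le (N' + j)%N; rewrite addnA -/K.
have := sigma_gt0 K; lra.
Unshelve. all: by end_near. Qed.

(** A positive value of the inferior limit would be witnessed by a tail with a
    positive infimum; this infimum is finite because the terms are. *)
Lemma limn_einf_eq0 (R : realType) (u : nat -> R) :
  (forall k, 0 <= u k) ->
  (forall m eps, 0 < eps -> ~ (forall k, eps <= u (k + m)%N)) ->
  limn_einf (fun k => (u k)%:E) = 0%E.
Proof.
move=> u0 unb; rewrite limn_einf_lim (cvg_lim _ (@cvg_einfs_sup _ _))//.
apply/eqP; rewrite eq_le; apply/andP; split.
  apply: ge_ereal_sup => _ [m _ <-]; rewrite /einfs /=.
  rewrite leNgt; apply/negP => inf_gt0.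
  have inf_le k : (ereal_inf (sdrop (fun k => (u k)%:E) m) <= (u (k + m)%N)%:E)%E.
    by apply: ereal_inf_lbound; exists (k + m)%N => //=; exact: leq_addl.
  move: inf_gt0 inf_le; case: ereal_inf => [e| |] //.
    rewrite lte_fin => e0 inf_le; apply: (unb m e e0) => k.
    by rewrite -lee_fin.
  by move=> _ /(_ 0%N).
apply: (@le_trans _ _ (einfs (fun k => (u k)%:E) 0%N)).
  by apply: le_ereal_inf_tmp => _ [k _ <-]; rewrite lee_fin.
by apply: ereal_sup_ubound; exists 0%N.
Qed.

Theorem theorem3p1 (R : realType) (n : nat)
    (f : 'cV[R]_n -> R) (g : 'cV[R]_n -> 'cV[R]_n)
    (f_C1 : continuously_differentiable_with_gradient f g)
    (P : marc_constants R) (P_admissible : admissible P)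
    (c1_gt1 : 1 < c1 P) (eta1_lt : eta1 P < 3 / 2)
    (x0 : 'cV[R]_n) (x : nat -> 'cV[R]_n) (sigma gamma : nat -> R)
    (run : marc_run P f g x0 x sigma gamma)
    (f_bounded_below : has_lbound (range (fun k => f (x k)))) :
  limn_einf (fun k => (enorm (g (x k)))%:E) = 0%E.
Proof.
have [_ /andP[c20 _] c11 [/andP[gmin0 gmin_init] init_gmax] si0] := P_admissible.
case: run => _ s0 g0 xS sS gS.
have sigma_gt0 k : 0 < sigma k.
  elim: k => [|k IH]; first by rewrite s0.
  rewrite sS; case: ifP => _; first exact: mulr_gt0.
  by case: ifP => _ //; rewrite mulr_gt0// (lt_le_trans ltr01).
have gamma_bnd k : 0 < gamma k <= gamma_max P.
  case: k => [|k]; first by rewrite g0 (lt_trans gmin0)// ltW.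
  have [gh _ ->] := gS k.
  rewrite lt_max gmin0 /= ge_max ge_min lexx orbT andbT.
  by rewrite ltW// (lt_trans gmin_init).
apply: limn_einf_eq0 => [k|m eps eps0]; first exact: enorm_ge0.
apply: (@gradients_not_bounded_away _ _ f g P (fun k => x (k + m)%N)
  (fun k => sigma (k + m)%N) (fun k => gamma (k + m)%N) (gamma_max P)) => //.
- by move=> k; exact: xS.
- by move=> k; exact: sS.
- case: f_bounded_below => b fb; exists b => _ [k _ <-].
  by apply: fb; exists (k + m)%N.
Qed.
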